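(* Consider the discrete-time finite single-hop network with $N$ queues and utility-maximising service described in the context. Assume that each $\xi_i$ is a Bernoulli random variable with $\mathbb{E}(\xi_i)=\lambda_i$, and that $\bar\nu\in\mathcal{C}$ and $\varepsilon>0$ are such that $\lambda_i<\nu_i-\varepsilon$ for each $i=1,\dots,N$. Let $\bar X$ be a random vector with the stationary distribution of the (positive recurrent) Markov chain $\bar X(\cdot)$. Then $$\sum_i h'(\nu_i)\,\mathbb{E}\,g(X_i)\ \le\ \frac1\varepsilon\sum_i h'(\nu_i)\,\mathbb{E}\,\Delta(X_i).$$
   Context: Model. There are $N<\infty$ queues. The queue-length vector $\bar X(k)=(X_1(k),\dots,X_N(k))\in\mathbb{Z}_+^N$ evolves as $$X_i(k+1)=X_i(k)+\xi_i(k)-\eta_i(k),\qquad k=0,1,\dots$$ Here $\xi_i(k)$ is the number of arrivals to queue $i$ in slot $k$; the vectors $(\xi_i(k))_{i}$ are i.i.d. over $k$, dependence between different $i$ is arbitrary, $\mathbb{E}\,\xi_i(k)=\lambda_i$, and $\xi_i$ denotes a generic copy of $\xi_i(k)$. The variables $\eta_i(k)\in\{0,1\}$ are the service completions; given $\bar X(k)$ their conditional law depends only on $\bar X(k)$, and $(\xi_i(k))_i$ is independent of the past, of $\bar X(k)$ and of $(\eta_i(k))_i$. The process $\bar X(\cdot)$ is a Markov chain on a countable state space, assumed irreducible. Service rates. Let $\psi_i(\bar x)=\mathbb{E}(\eta_i(k)\mid \bar X(k)=\bar x)$. It is assumed that $\psi_i(\bar x)\in[0,1]$, that $\psi_i(\bar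 x)=0$ if $x_i=0$, and that for every $\bar x$ $$\bar\psi(\bar x)\in\arg\max_{\bar\mu\in\mathcal{C}}\ \sum_i g(x_i)h(\mu_i),$$ where $\mathcal{C}\subset\mathbb{R}_+^N$ is compact and coordinate-convex (if $\bar\mu\in\mathcal{C}$ and $0\le\bar\mu^*\le\bar\mu$ coordinate-wise, then $\bar\mu^*\in\mathcal{C}$); $\mathcal{C}$ is not assumed convex. The convention $0\cdot(-\infty)=0$ is used. Condition on $h$: $h:[0,\infty)\to\mathbb{R}$ is strictly increasing, differentiable and concave, where both $\lim_{y\downarrow0}h(y)=h(0)>-\infty$ and $\lim_{y\downarrow 0}h(y)=-\infty$ (with $h(0)=-\infty$) are allowed. Condition on $g$: $g:\mathbb{Z}_+\to[0,\infty)$ is strictly increasing and $g(y)/\Delta(y)\to\infty$ as $y\to\infty$, where $\Delta(y)=g(y+1)-g(y)$ (equivalently $g(y+1)/g(y)\to1$). Under these assumptions the chain is positive recurrent, so the stationary distribution exists and is unique. *)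

(* Defs.v *)
From HB Require Import structures.
From mathcomp Require Export all_boot all_order all_algebra.
From mathcomp Require Export all_classical all_reals all_analysis.
Set Implicit Arguments.
Unset Strict Implicit.
Unset Printing Implicit Defensive.
Export Order.TTheory GRing.Theory Num.Theory.
Export numFieldNormedType.Exports.

Local Open Scope classical_set_scope.
Local Open Scope ring_scope.

(** * Countable Markov chains

    [S] is the state space, a set of points of the countable set [N.-tuple nat];
    [p x y] is the one-step transition probability from [x] to [y].  The values
    of [p] outside [S] are irrelevant. *)

Definition stochastic_matrix (R : realType) (N : nat) (S : set (N.-tuple nat))
    (p : N.-tuple nat -> N.-tuple nat -> R) : Prop :=
  (forall x y, S x -> S y -> 0 <= p x y) /\
  (forall x, S x -> (\esum_(y in S) (p x y)%:E)%E = 1%E).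

(** The initial distribution is arbitrary. *)
Definition markov_chain (d : measure_display) (T : measurableType d)
    (R : realType) (P : probability T R) (N : nat) (S : set (N.-tuple nat))
    (p : N.-tuple nat -> N.-tuple nat -> R)
    (X : nat -> {RV P >-> N.-tuple nat}) : Prop :=
  [/\ stochastic_matrix S p,
      forall k w, S (X k w)
    & forall (k : nat) (x : nat -> N.-tuple nat),
        (forall j, S (x j)) ->
        P [set w | forall j, (j <= k.+1)%N -> X j w = x j] =
        (P [set w | forall j, (j <= k)%N -> X j w = x j] *
         (p (x k) (x k.+1))%:E)%E].

Fixpoint nstep (R : realType) (N : nat) (S : set (N.-tuple nat))
    (p : N.-tuple nat -> N.-tuple nat -> R) (n : nat)
    (x y : N.-tuple nat) : \bar R :=
  if n is m.+1 then (\esum_(z in S) ((p x z)%:E * nstep S p m z y))%E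
  else ((x == y)%:R)%:E.

Definition irreducible (R : realType) (N : nat) (S : set (N.-tuple nat))
    (p : N.-tuple nat -> N.-tuple nat -> R) : Prop :=
  forall x y, S x -> S y -> exists n, (0 < nstep S p n x y)%E.

Definition stationary_distribution (R : realType) (N : nat)
    (S : set (N.-tuple nat)) (p : N.-tuple nat -> N.-tuple nat -> R)
    (m : set (N.-tuple nat) -> \bar R) : Prop :=
  m S = 1%E /\
  forall y, S y -> m [set y] = (\esum_(x in S) (m [set x] * (p x y)%:E))%E.

(** * The queueing network *)

(** The atoms of the information available at the beginning of slot [k]: the
    queue lengths up to time [k], and the arrivals and service completions in
    the slots [0, ..., k - 1].  All the variables are discrete, so independence
    of, and conditioning on, the past are expressed on these atoms. *)
Definition past (T : Type) (N : nat) (X xi : nat -> T -> N.-tuple nat)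
    (eta : nat -> T -> N.-tuple bool) (k : nat) (x a : nat -> N.-tuple nat)
    (e : nat -> N.-tuple bool) : set T :=
  [set w | (forall j, (j <= k)%N -> X j w = x j) /\
           (forall j, (j < k)%N -> xi j w = a j /\ eta j w = e j)].

(** [alpha] is the common law of the arrival vectors [xi k], that is, the law of
    a generic arrival vector; [sigma x] is the conditional law of [eta k] given
    [X k = x].  The components of [xi k], and those of [eta k], may be
    dependent.  Since [alpha] does not depend on [k], [arrivals] says both that
    the [xi k] are i.i.d. and that [xi k] is independent of the past and of
    [eta k]. *)
Record queueing_network (d : measure_display) (T : measurableType d)
    (R : realType) (P : probability T R) (N : nat)
    (alpha : probability (N.-tuple nat) R)
    (sigma : N.-tuple nat -> probability (N.-tuple bool) R)
    (X xi : nat -> {RV P >-> N.-tuple nat})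
    (eta : nat -> {RV P >-> N.-tuple bool}) : Prop := {
  dynamics : forall (k : nat) (i : 'I_N) (w : T),
    (tnth (X k.+1 w) i)%:Z =
    (tnth (X k w) i)%:Z + (tnth (xi k w) i)%:Z - (tnth (eta k w) i : nat)%:Z;
  services : forall k x a e b,
    P (past X xi eta k x a e `&` [set w | eta k w = b]) =
    (P (past X xi eta k x a e) * sigma (x k) [set b])%E;
  arrivals : forall k x a e b c,
    P (past X xi eta k x a e `&` [set w | eta k w = b] `&`
       [set w | xi k w = c]) =
    (P (past X xi eta k x a e `&` [set w | eta k w = b]) * alpha [set c])%E
}.

(** The vector [psi x] of the means of the components of [eta k] given
    [X k = x].  Its entries are in [0, 1] because [eta k] is Boolean-valued. *)
Definition service_rate (R : realType) (N : nat)
    (sigma : N.-tuple nat -> probability (N.-tuple bool) R)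
    (x : N.-tuple nat) : 'rV[R]_N :=
  \row_(i < N) fine 'E_(sigma x)[fun b : N.-tuple bool => (tnth b i)%:R].

Definition bernoulli_variable (d : measure_display) (T : measurableType d)
    (R : realType) (P : probability T R) (Z : T -> nat) : Prop :=
  P [set w | Z w = 0%N \/ Z w = 1%N] = 1%E.

Definition coordinate_convex (R : realType) (N : nat) (C : set 'rV[R]_N) : Prop :=
  forall mu mu' : 'rV[R]_N, C mu ->
    (forall i, 0 <= mu' ord0 i <= mu ord0 i) -> C mu'.

(** The objective takes values in the extended reals, as [h 0] may be [-oo];
    the product of extended reals satisfies [0 * -oo = 0]. *)
Definition total_utility (R : realType) (N : nat) (g : nat -> R)
    (h : R -> \bar R) (x : N.-tuple nat) (mu : 'rV[R]_N) : \bar R :=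
  (\sum_(i < N) ((g (tnth x i))%:E * h (mu ord0 i)))%E.

Definition is_argmax (R : realType) (V : Type) (C : set V) (F : V -> \bar R)
    (v : V) : Prop :=
  C v /\ forall u, C u -> (F u <= F v)%E.

(** Only the values of [h] at nonnegative points matter; they are finite, except
    that [h 0] may be [-oo].  Differentiability is required at positive points
    only, so that, e.g., the square root is allowed. *)
Record utility_condition (R : realType) (h : R -> \bar R) : Prop := {
  h_finite : forall y : R, 0 < y -> h y \is a fin_num;
  h_increasing : forall y z : R, 0 <= y -> y < z -> (h y < h z)%E;
  h_differentiable : forall y : R, 0 < y -> derivable (fine \o h) y 1;
  h_concave : forall t y z : R, 0 <= t <= 1 -> 0 <= y -> 0 <= z ->
    (t%:E * h y + (1 - t)%:E * h z <= h (t * y + (1 - t) * z)%R)%E;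
  h_right_limit : h y @[y --> 0^'+] --> h 0
}.

Definition increment (R : realType) (g : nat -> R) (y : nat) : R :=
  g y.+1 - g y.

Record weight_condition (R : realType) (g : nat -> R) : Prop := {
  g_nonneg : forall y, 0 <= g y;
  g_increasing : {homo g : y z / (y < z)%N >-> y < z};
  g_ratio : g y / increment g y @[y --> \oo] --> +oo
}.

(* Main.v *)
(** Let [c_i = h'(nu_i)] and let [V x] be the sum over [i] of
    [c_i (g 1 + ... + g x_i)].  With Bernoulli arrivals every coordinate moves by
    at most one, and the expected increment of [V] from [x] is the sum over [i] of
    [c_i (g x_i (lambda_i - psi_i) + (g (x_i + 1) - g x_i) lambda_i (1 - psi_i))].
    The tangent of the concave [h] at [nu_i] and the optimality of [psi] give
    [sum_i c_i g x_i (nu_i - psi_i) <= 0], so this increment is at most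
    [- eps sum_i c_i g x_i + sum_i c_i (g (x_i + 1) - g x_i)].  Averaging over the
    stationary distribution, with [V] truncated because its mean may be infinite,
    yields the bound.

    The transition matrix is only related to the network along trajectories of
    positive probability; by irreducibility every state ends such a trajectory. *)
Require Import Defs.
From mathcomp Require Import zify ring lra measurable_realfun.
Set Implicit Arguments.
Unset Strict Implicit.
Unset Printing Implicit Defensive.
Local Open Scope classical_set_scope.
Local Open Scope ring_scope.

(** * Measurability and integration for variables with countably many values *)

Lemma measurable_tuple_set1 (N : nat) (d : measure_display)
    (U : measurableType d) (x : N.-tuple U) :
  (forall u : U, measurable [set u]) -> measurable [set x].
Proof.
move=> mU.
have -> : [set x] =
    \bigcap_(i in [set: 'I_N]) ((@tnth N U ^~ i) @^-1` [set tnth x i]).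
  apply/seteqP; split=> [y /= -> //|y yx].
  by apply: eq_from_tnth => i; exact: yx.
apply: fin_bigcap_measurable => // i _.
by rewrite -[X in measurable X]setTI; exact: measurable_tnth.
Qed.

(** The sigma-algebra on tuples is the product one. It contains the singletons, and the type is
    countable, so it contains every set. *)
Lemma measurable_tuple_nat (N : nat) (A : set (N.-tuple nat)) : measurable A.
Proof.
apply: countable_measurable => [x|]; last exact: countableP.
exact: measurable_tuple_set1.
Qed.

Lemma measurable_tuple_bool (N : nat) (A : set (N.-tuple bool)) : measurable A.
Proof.
apply: countable_measurable => [x|]; last exact: countableP.
exact: measurable_tuple_set1.
Qed.

Section discrete.
Context (d : measure_display) (T : measurableType d) (R : realType)
  (mu : {measure set T -> \bar R}) (U : countType) (f : T -> U)
  (mf : forall u, measurable [set w | f w = u]).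

Lemma measurable_discrete (A : set U) : measurable (f @^-1` A).
Proof.
have -> : f @^-1` A =
    \bigcup_u (if u \in A then [set w | f w = u] else set0).
  apply/seteqP; split=> [w Aw|w [u _ /=]].
    by exists (f w) => //; rewrite mem_set.
  by case: ifPn => // /set_mem Au /= ->.
by apply: countable_bigcupT_measurable => // u; case: ifPn.
Qed.

Lemma measurable_fun_discrete (d' : measure_display) (V : sigmaRingType d')
    (D : set T) (phi : U -> V) :
  measurable_fun D (fun w => phi (f w)).
Proof.
move=> mD B _; apply: measurableI => //.
exact: (measurable_discrete (phi @^-1` B)).
Qed.

(** The level sets of [f] cut [D] into countably many pieces, on each of which the integrand is
    constant. *)
Lemma integral_discrete (S : set U) (D : set T) (phi : U -> \bar R) :
  measurable D -> (forall w, D w -> S (f w)) -> (forall u, 0 <= phi u)%E ->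
  (\int[mu]_(w in D) phi (f w) =
   \esum_(u in S) (phi u * mu (D `&` [set w | f w = u])))%E.
Proof.
move=> mD DS phi0.
(* Indexing the pieces by the code of the value turns the partition into a sequence; a number that
   codes no value gives an empty piece. *)
pose F n := D `&` [set w | pickle (f w) = n].
have mF n : measurable (F n).
  apply: measurableI => //.
  exact: (measurable_discrete [set u | pickle u = n]).
have DE : D = \bigcup_n F n.
  by apply/seteqP; split=> [w Dw|w [n _ []//]]; exists (pickle (f w)).
have tF : trivIset setT F.
  by move=> i j _ _ [w [[_ /= <-] [_ /= <-]]].
rewrite {1}DE ge0_integral_bigcup//; last first.
  exact: measurable_fun_discrete.
rewrite nneseries_esumT; last by move=> n; exact: integral_ge0.
have FE u : F (pickle u) = D `&` [set w | f w = u].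
  apply/seteqP; split=> [w [Dw /= /(pcan_inj pickleK) <-]//|w [Dw /= <-]//].
have -> : (\esum_(u in S) (phi u * mu (D `&` [set w | f w = u])) =
    \esum_(u in S) \int[mu]_(w in F (pickle u)) phi (f w))%E.
  apply: eq_esum => u Su; rewrite FE.
  rewrite (eq_integral (fun=> phi u)); last by move=> w /set_mem[_ /= ->].
  by rewrite integral_cst//; exact: measurableI.
rewrite -(@esum_image _ _ _ S pickle (fun n => \int[mu]_(w in F n) phi (f w))%E);
  last by move=> u v _ _; exact: (pcan_inj pickleK).
(* A code outside the image of [S] contributes nothing, since [f] maps [D] into [S]. *)
rewrite [RHS]esum_mkcond; apply: eq_esum => n _; case: ifPn => // nS.
rewrite [F n](_ : _ = set0) ?integral_set0//.
rewrite -subset0 => w [Dw /= fn]; move/negP: nS; apply; apply/mem_set.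
by exists (f w) => //; exact: DS.
Qed.

Lemma measure_discrete (S : set U) (D : set T) :
  measurable D -> (forall w, D w -> S (f w)) ->
  mu D = (\esum_(u in S) mu (D `&` [set w | f w = u]))%E.
Proof.
move=> mD DS; rewrite -[LHS]mul1e -integral_cst//.
rewrite (@integral_discrete S D (fun=> 1%E))//.
by under eq_esum do rewrite mul1e.
Qed.

End discrete.

(** Both sides are sums over the values in [B], compared term by term. This extends identities known
    on atoms, such as those defining the network, to arbitrary events. *)
Lemma measure_proportional (d1 d2 : measure_display) (T1 : measurableType d1)
    (T2 : measurableType d2) (R : realType) (U : countType)
    (m1 : {measure set T1 -> \bar R}) (m2 : {measure set T2 -> \bar R})
    (f1 : T1 -> U) (f2 : T2 -> U) (A1 : set T1) (A2 : set T2) (r : \bar R)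
    (B : set U) :
  (forall u, measurable [set w | f1 w = u]) ->
  (forall u, measurable [set w | f2 w = u]) ->
  measurable A1 -> measurable A2 -> (0 <= r)%E -> r \is a fin_num ->
  (forall u, B u -> m1 (A1 `&` [set w | f1 w = u]) =
                    (r * m2 (A2 `&` [set w | f2 w = u]))%E) ->
  m1 (A1 `&` f1 @^-1` B) = (r * m2 (A2 `&` f2 @^-1` B))%E.
Proof.
move=> mf1 mf2 mA1 mA2; case: r => // r; rewrite lee_fin => r0 _ m12.
have subE (V : Type) (f : V -> U) (A : set V) u : B u ->
    A `&` f @^-1` B `&` [set w | f w = u] = A `&` [set w | f w = u].
  move=> Bu; apply/seteqP; split=> [w [[Aw _] fw]//|w [Aw /= fw]].
  by split => //; split => //=; rewrite fw.
rewrite (@measure_discrete _ _ _ m1 _ f1 mf1 B); last 2 first.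
- by apply: measurableI => //; exact: measurable_discrete.
- by move=> w [].
(* The factor is absorbed into a scaled measure, so that the same decomposition applies on the
   right. *)
have -> : (r%:E * m2 (A2 `&` f2 @^-1` B))%E =
    mscale (NngNum r0) m2 (A2 `&` f2 @^-1` B) by [].
rewrite (@measure_discrete _ _ _ (mscale (NngNum r0) m2) _ f2 mf2 B);
  last 2 first.
- by apply: measurableI => //; exact: measurable_discrete.
- by move=> w [].
by apply: eq_esum => u Bu; rewrite !subE// m12.
Qed.

(** * Conditioning on trajectories of positive probability *)

Lemma measurable_tuple_nat_fiber (d : measure_display) (T : measurableType d)
    (R : realType) (P : probability T R) (N : nat) (Z : {RV P >-> N.-tuple nat})
    (x : N.-tuple nat) : measurable [set w | Z w = x].
Proof. exact: (measurable_funPTI Z (measurable_tuple_nat [set x])). Qed.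

Lemma measurable_tuple_bool_fiber (d : measure_display) (T : measurableType d)
    (R : realType) (P : probability T R) (N : nat)
    (Z : {RV P >-> N.-tuple bool})
    (x : N.-tuple bool) : measurable [set w | Z w = x].
Proof. exact: (measurable_funPTI Z (measurable_tuple_bool [set x])). Qed.

Definition trajectory {T : Type} {N : nat} (X : nat -> T -> N.-tuple nat)
    (k : nat) (x : nat -> N.-tuple nat) : set T :=
  [set w | forall j, (j <= k)%N -> X j w = x j].

Lemma measurable_trajectory (d : measure_display) (T : measurableType d)
    (R : realType) (P : probability T R) (N : nat)
    (X : nat -> {RV P >-> N.-tuple nat}) (k : nat) (x : nat -> N.-tuple nat) :
  measurable (trajectory X k x).
Proof.
have -> : trajectory X k x = \bigcap_(j in `I_k.+1) [set w | X j w = x j] by [].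
apply: fin_bigcap_measurable => [|j _]; first exact: finite_II.
exact: measurable_tuple_nat_fiber.
Qed.

(** The network is specified on atoms of the whole past, whereas a trajectory fixes only queue
    lengths. Summation runs over the past arrivals and services, then over the values of [eta k] in
    [B], then over those of [xi k] in [D]. *)
Lemma joint_law (d : measure_display) (T : measurableType d)
    (R : realType) (P : probability T R) (N : nat)
    (alpha : probability (N.-tuple nat) R)
    (sigma : N.-tuple nat -> probability (N.-tuple bool) R)
    (X xi : nat -> {RV P >-> N.-tuple nat})
    (eta : nat -> {RV P >-> N.-tuple bool})
    (k : nat) (x : nat -> N.-tuple nat) (B : set (N.-tuple bool))
    (D : set (N.-tuple nat)) :
  queueing_network alpha sigma X xi eta ->
  P (trajectory X k x `&` eta k @^-1` B `&` xi k @^-1` D) =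
  (P (trajectory X k x) * sigma (x k) B * alpha D)%E.
Proof.
move=> net.
set A := trajectory X k x.
have mA : measurable A by exact: measurable_trajectory.
have mxi j c : measurable [set w | xi j w = c].
  exact: measurable_tuple_nat_fiber.
have meta j b : measurable [set w | eta j w = b].
  exact: measurable_tuple_bool_fiber.
(* A finite sequence, so that the past arrivals and services form one variable with values in a
   countable type. The default [o] below is never relevant: only entries of index less than [k] are
   constrained. *)
pose hist w := mkseq (fun j => (xi j w, eta j w)) k.
pose o : N.-tuple nat * N.-tuple bool :=
  ([tuple of nseq N 0%N], [tuple of nseq N false]).
have histP u w : hist w = u <->
    size u = k /\ forall j, (j < k)%N -> (xi j w, eta j w) = nth o u j.
  split=> [<-|[su uE]].
    by rewrite size_mkseq; split=> // j jk; rewrite nth_mkseq.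
  apply: (@eq_from_nth _ o); rewrite size_mkseq// => j jk.
  by rewrite nth_mkseq// uE.
have pastE u : size u = k -> A `&` [set w | hist w = u] =
    past X xi eta k x (fun j => (nth o u j).1) (fun j => (nth o u j).2).
  move=> su; apply/seteqP; split=> w.
    by move=> [Aw /histP[_ uE]]; split=> // j jk; rewrite -uE.
  move=> [Aw uE]; split=> //=; apply/histP; split=> // j jk.
  by have [-> ->] := uE _ jk; case: (nth o u j).
have mhist u : measurable [set w | hist w = u].
  have [su|su] := eqVneq (size u) k; last first.
    rewrite [X in measurable X](_ : _ = set0)//.
    by rewrite -subset0 => w /histP[/eqP]; rewrite (negPf su).
  have -> : [set w | hist w = u] = \bigcap_(j in `I_k)
      ([set w | xi j w = (nth o u j).1] `&` [set w | eta j w = (nth o u j).2]).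
    apply/seteqP; split=> [w /histP[_ uE] j jk|w uE].
      by rewrite -uE.
    apply/histP; split=> // j jk; have [/= -> ->] := uE _ jk.
    by case: (nth o u j).
  apply: fin_bigcap_measurable => [|j _]; first exact: finite_II.
  exact: measurableI.
have atom b c : P (A `&` [set w | eta k w = b] `&` [set w | xi k w = c]) =
    (P A * sigma (x k) [set b] * alpha [set c])%E.
  (* Intersecting with the trivial event that [hist] takes some value exposes the sum over all
     histories. *)
  rewrite -(setIT (_ `&` [set w | xi k w = c])) -(preimage_setT hist).
  rewrite (@measure_proportional _ _ _ _ _ _ P P hist hist _ A
    (sigma (x k) [set b] * alpha [set c])%E)//; last 4 first.
  - by apply: measurableI => //; exact: measurableI.
  - exact: mule_ge0.
  - by rewrite fin_numM ?fin_num_measure//; exact: measurable_tuple_set1.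
  - move=> u _; have [su|su] := eqVneq (size u) k; last first.
      have u0 : [set w | hist w = u] = set0.
        by rewrite -subset0 => w /histP[/eqP]; rewrite (negPf su).
      by rewrite u0 !setI0 measure0 mule0.
    rewrite (_ : _ `&` [set w | hist w = u] = A `&` [set w | hist w = u]
      `&` [set w | eta k w = b] `&` [set w | xi k w = c]); last first.
      by rewrite -!setIA; congr (_ `&` _); rewrite setIA setIC.
    rewrite pastE//; apply: (etrans (arrivals net _ _ _ _ _ _)).
    rewrite (services net) -muleA. exact: muleC.
  by rewrite preimage_setT setIT [LHS]muleC muleA.
have slice c : P (A `&` [set w | xi k w = c] `&` eta k @^-1` B) =
    (P A * alpha [set c] * sigma (x k) B)%E.
  rewrite (@measure_proportional _ _ _ _ _ _ P (sigma (x k)) (eta k) id _ setT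
    (P A * alpha [set c])%E)//; last 5 first.
  - by move=> b; exact: measurable_tuple_set1.
  - exact: measurableI.
  - exact: mule_ge0.
  - by rewrite fin_numM ?fin_num_measure//; exact: measurable_tuple_set1.
  - by move=> b _; rewrite setTI setIAC; apply: (etrans (atom b c)); exact: muleAC.
  by rewrite setTI preimage_id.
rewrite (@measure_proportional _ _ _ _ _ _ P alpha (xi k) id _ setT
  (P A * sigma (x k) B)%E)//; last 5 first.
- by move=> c; exact: measurable_tuple_set1.
- apply: measurableI => //; exact: measurable_discrete.
- exact: mule_ge0.
- rewrite fin_numM ?fin_num_measure//.
  exact: measurable_tuple_bool.
- by move=> c _; rewrite setTI setIAC; apply: (etrans (slice c)); exact: muleAC.
by rewrite setTI preimage_id.
Qed.

Lemma trajectory_step (d : measure_display) (T : measurableType d)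
    (R : realType) (P : probability T R) (N : nat) (S : set (N.-tuple nat))
    (p : N.-tuple nat -> N.-tuple nat -> R)
    (X : nat -> {RV P >-> N.-tuple nat}) (k : nat) (x : nat -> N.-tuple nat)
    (y : N.-tuple nat) :
  markov_chain S p X -> (forall j, S (x j)) -> S y ->
  P (trajectory X k x `&` [set w | X k.+1 w = y]) =
  (P (trajectory X k x) * (p (x k) y)%:E)%E.
Proof.
move=> [_ _ step] Sx Sy.
(* The Markov property is stated for one infinite sequence of states, so [y] is spliced in after
   time [k]. *)
pose x' j := if (j <= k)%N then x j else y.
have Sx' j : S (x' j) by rewrite /x'; case: ifP.
have xx' : trajectory X k x' = trajectory X k x.
  by apply/seteqP; split=> w wx j jk; have := wx j jk; rewrite /x' jk.
have x'k : x' k = x k by rewrite /x' leqnn.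
have x'k1 : x' k.+1 = y by rewrite /x' ltnn.
have : P (trajectory X k.+1 x') =
  (P (trajectory X k x') * (p (x' k) (x' k.+1))%:E)%E by exact: step.
rewrite xx' x'k x'k1 => <-; congr (P _).
apply/seteqP; split=> w.
  move=> [wx wy] j; rewrite leq_eqVlt => /predU1P[->|jk].
    by rewrite /x' ltnn.
  by rewrite /x' -ltnS jk; exact: wx.
move=> wx; split => [j jk|].
  by have := wx j (leqW jk); rewrite /x' jk.
by have := wx k.+1 (leqnn _); rewrite /x' ltnn.
Qed.

Lemma nstep_ge0 (R : realType) (N : nat) (S : set (N.-tuple nat))
    (p : N.-tuple nat -> N.-tuple nat -> R) (n : nat) (x y : N.-tuple nat) :
  (forall x y, S x -> S y -> 0 <= p x y) -> S x -> (0 <= nstep S p n x y)%E.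
Proof.
move=> p0; elim: n x => [|n IHn] x Sx /=; first by rewrite lee_fin.
by apply: esum_ge0 => z Sz; rewrite mule_ge0 ?lee_fin ?p0// IHn.
Qed.

(** Some initial state has positive probability, because the law of [X 0] has mass one on the
    countable set [S]; a path of positive transition probabilities then extends the trajectory to
    [y]. *)
Lemma reachable (d : measure_display) (T : measurableType d)
    (R : realType) (P : probability T R) (N : nat) (S : set (N.-tuple nat))
    (p : N.-tuple nat -> N.-tuple nat -> R)
    (X : nat -> {RV P >-> N.-tuple nat}) (y : N.-tuple nat) :
  markov_chain S p X -> irreducible S p -> S y ->
  exists k x, [/\ forall j, S (x j), x k = y & (0 < P (trajectory X k x))%E].
Proof.
move=> chain irr Sy.
have [[p0 _] XS _] := chain.
pose reach z := exists k x,
  [/\ forall j, S (x j), x k = z & (0 < P (trajectory X k x))%E].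
have reach_step x z : reach x -> S z -> 0 < p x z -> reach z.
  move=> [k [u [Su <- Pu]]] Sz pz.
  exists k.+1, (fun j => if (j <= k)%N then u j else z); split.
  - by move=> j; case: ifP.
  - by rewrite ltnn.
  rewrite [trajectory _ _ _](_ : _ =
      trajectory X k u `&` [set w | X k.+1 w = z]).
    by rewrite (trajectory_step _ chain)// mule_gt0.
  apply/seteqP; split=> w.
    move=> wx; split => [j jk|].
      by have := wx j (leqW jk); rewrite jk.
    by have := wx k.+1 (leqnn _); rewrite ltnn.
  move=> [wx wz] j; rewrite leq_eqVlt => /predU1P[->|jk].
    by rewrite ltnn.
  by rewrite -ltnS jk; exact: wx.
have [x0 Sx0 x0_reach] : exists2 x0, S x0 & reach x0.
  apply: contrapT => /forall2NP none.
  have : P [set: T] = 0%E.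
    rewrite (@measure_discrete _ _ _ P _ (X 0%N) _ S)//; last first.
      by move=> x; exact: measurable_tuple_nat_fiber.
    apply: esum1 => x Sx; apply/eqP; rewrite eq_le measure_ge0 andbT leNgt.
    apply/negP => Px; have [//|] := none x; apply.
    exists 0%N, (fun=> x); split => //.
    rewrite (_ : trajectory _ _ _ = [set: T] `&` [set w | X 0%N w = x])//.
    apply/seteqP; split=> w; first by move=> wx; split => //; exact: wx.
    by move=> [_ wx] j; rewrite leqn0 => /eqP ->.
  by rewrite probability_setT => /eqP; rewrite onee_eq0.
have [n] := irr x0 y Sx0 Sy.
elim: n x0 Sx0 x0_reach => [|n IHn] x Sx x_reach /=.
  by case: eqVneq => [<- //|_]; rewrite ltxx.
(* Contrapositive: if no such trajectory ends at [y], every term of the sum over the intermediate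
   state [z] vanishes, by the induction hypothesis at [z] when [p x z] is positive. *)
apply: contraPP => /forallNP none; apply/negP; rewrite -leNgt.
rewrite esum1// => z Sz.
have pxz := p0 x z Sx Sz.
have [pz|] := ltP 0 (p x z); last first.
  by move=> pz; rewrite (_ : p x z = 0) ?mul0e//; apply: le_anti; rewrite pz.
have [nz|] := ltP 0%E (nstep S p n z y).
  have [k [u uP]] := IHn z Sz (reach_step _ _ x_reach Sz pz) nz.
  by exfalso; apply: (none k); exists u.
move=> nz; rewrite (_ : nstep S p n z y = 0%E) ?mule0//.
by apply: le_anti; rewrite nz nstep_ge0.
Qed.

(** The measure is [P] conditioned on a trajectory of positive probability ending at [x]. It links
    the two descriptions of one slot: the laws [sigma x] and [alpha] on one side, the kernel [p] on
    the other. *)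
Lemma conditional_law (d : measure_display) (T : measurableType d)
    (R : realType) (P : probability T R) (N : nat)
    (alpha : probability (N.-tuple nat) R)
    (sigma : N.-tuple nat -> probability (N.-tuple bool) R)
    (X xi : nat -> {RV P >-> N.-tuple nat})
    (eta : nat -> {RV P >-> N.-tuple bool})
    (S : set (N.-tuple nat)) (p : N.-tuple nat -> N.-tuple nat -> R)
    (x : N.-tuple nat) :
  queueing_network alpha sigma X xi eta ->
  markov_chain S p X -> irreducible S p -> S x ->
  exists (k : nat) (mu : {measure set T -> \bar R}),
    [/\ mu [set w | X k w <> x] = 0%E,
        forall B D, mu (eta k @^-1` B `&` xi k @^-1` D) = (sigma x B * alpha D)%E
      & forall F : N.-tuple nat -> \bar R, (forall y, 0 <= F y)%E ->
        (\int[mu]_w F (X k.+1 w) = \esum_(y in S) (F y * (p x y)%:E))%E].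
Proof.
move=> net chain irr Sx.
have [k [u [Su ux Pu]]] := reachable chain irr Sx.
have mA : measurable (trajectory X k u) by exact: measurable_trajectory.
have PAfin : P (trajectory X k u) \is a fin_num by exact: fin_num_measure.
pose c := fine (P (trajectory X k u)).
have PAE : P (trajectory X k u) = c%:E by rewrite fineK.
have c0 : 0 < c by move: Pu; rewrite PAE lte_fin.
have ci0 : 0 <= c^-1 by rewrite invr_ge0 ltW.
pose mu : {measure set T -> \bar R} := mscale (NngNum ci0) (mrestr P mA).
have muE B : mu B = ((c^-1)%:E * P (trajectory X k u `&` B))%E.
  by rewrite setIC.
have cK e : ((c^-1)%:E * (P (trajectory X k u) * e))%E = e.
  by rewrite PAE muleA -EFinM mulVf ?mul1e// gt_eqF.
exists k, mu; split.
- rewrite muE (_ : _ `&` _ = set0) ?measure0 ?mule0//.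
  by rewrite -subset0 => w [/(_ k (leqnn _))] /= ->; rewrite ux.
- move=> B D; rewrite muE setIA (joint_law _ _ _ _ net).
  by rewrite -muleA cK ux.
- move=> F F0; have XS : forall k w, S (X k w) by case: chain.
  rewrite (@integral_discrete _ _ _ mu _ (X k.+1) _ S)//; last first.
    by move=> y; exact: measurable_tuple_nat_fiber.
  apply: eq_esum => y Sy; congr (_ * _)%E; rewrite setTI muE.
  by rewrite (trajectory_step _ chain)// cK ux.
Qed.

(** * Means over one slot and the drift of the Lyapunov function *)

Lemma service_rateE (R : realType) (N : nat)
    (sigma : N.-tuple nat -> probability (N.-tuple bool) R) (x : N.-tuple nat)
    (i : 'I_N) :
  sigma x [set b : N.-tuple bool | tnth b i] = (service_rate sigma x ord0 i)%:E.
Proof.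
rewrite mxE unlock.
have mB : measurable [set b : N.-tuple bool | tnth b i].
  exact: measurable_tuple_bool.
rewrite (_ : (fun b => _) =
    (fun b => (\1_[set b : N.-tuple bool | tnth b i] b)%:E)).
  by rewrite integral_indic// setIT fineK// fin_num_measure.
apply/funext => b; rewrite indicE; congr ((_ : bool)%:R%:E).
by apply/idP/idP => [/mem_set|/set_mem].
Qed.

(** Almost surely the variable equals the indicator of the event that it is 1, so its mean is the
    probability of that event. *)
Lemma bernoulli_variable_law (R : realType) (N : nat)
    (alpha : probability (N.-tuple nat) R) (i : 'I_N) (l : R) :
  bernoulli_variable alpha (fun a : N.-tuple nat => tnth a i) ->
  ('E_alpha[fun a : N.-tuple nat => (tnth a i)%:R] = l%:E)%E ->
  [/\ alpha [set a | tnth a i = 0%N] = (1 - l)%:E,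
      alpha [set a | tnth a i = 1%N] = l%:E,
      alpha [set a | ~ (tnth a i = 0%N \/ tnth a i = 1%N)] = 0%E
    & 0 <= l <= 1].
Proof.
rewrite /bernoulli_variable unlock => bern mean.
pose A n := [set a : N.-tuple nat | tnth a i = n].
have mA n : measurable (A n) by exact: measurable_tuple_nat.
have A01 : [set a | tnth a i = 0%N \/ tnth a i = 1%N] = A 0%N `|` A 1%N by [].
have mA01 : measurable (A 0%N `|` A 1%N) by exact: measurableU.
have other : alpha [set a | ~ (tnth a i = 0%N \/ tnth a i = 1%N)] = 0%E.
  by rewrite -[X in alpha X]/(~` [set a | tnth a i = 0%N \/ tnth a i = 1%N])
    A01 probability_setC// -A01 bern subee.
have one : alpha (A 1%N) = l%:E.
  rewrite -mean; transitivity (\int[alpha]_a (\1_(A 1%N) a)%:E)%E.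
    by rewrite integral_indic// setIT.
  apply: ge0_ae_eq_integral => //.
  - by move=> _ B _; exact: measurable_tuple_nat.
  - by move=> _ B _; exact: measurable_tuple_nat.
  - exists [set a | ~ (tnth a i = 0%N \/ tnth a i = 1%N)]; split => //.
      exact: measurable_tuple_nat.
    move=> a /= na aN; apply: na => _; rewrite indicE.
    by case: aN => aN; rewrite aN; [rewrite memNset// /A/= aN|rewrite mem_set].
have zero : alpha (A 0%N) = (1 - l)%:E.
  have a0fin : alpha (A 0%N) \is a fin_num by exact: fin_num_measure.
  have : (alpha (A 0%N) + alpha (A 1%N) = 1)%E.
    rewrite -bern A01 measureU//.
    by rewrite -subset0 => a [/= a0]; rewrite /A/= a0.
  by rewrite one -(fineK a0fin) -EFinD => -[<-]; rewrite addrK.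
split => //; rewrite -!lee_fin -one measure_ge0/=; exact: probability_le1.
Qed.

(* The sum starts at [g 1]: with this shift the drift produces [increment g] at
   the current queue length, not at the next one. *)
Definition cumul {R : realType} (g : nat -> R) (n : nat) : R :=
  \sum_(1 <= j < n.+1) g j.

Lemma cumulS (R : realType) (g : nat -> R) (n : nat) :
  cumul g n.+1 = cumul g n + g n.+1.
Proof. by rewrite /cumul big_nat_recr. Qed.

(** An arrival and a completion in the same slot cancel. The loss is added on the left rather than
    subtracted on the right, so that for nonnegative [g] both sides are nonnegative and can be
    integrated without finiteness conditions. *)
Lemma cumul_step (R : realType) (g : nat -> R) (n n' a : nat) (e : bool) :
  (n'%:Z = n%:Z + a%:Z - (e : nat)%:Z) -> a = 0%N \/ a = 1%N ->
  cumul g n' + g n * (e && (a == 0%N))%:R =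
  cumul g n + g n.+1 * (~~ e && (a == 1%N))%:R.
Proof.
move=> dyn [] aE; subst a; case: e dyn => /= dyn.
- have -> : n = n'.+1 by lia.
  by rewrite cumulS mulr1 mulr0 addr0.
- have -> : n' = n by lia.
  by rewrite !mulr0.
- have -> : n' = n by lia.
  by rewrite !mulr0.
- have -> : n' = n.+1 by lia.
  by rewrite cumulS mulr1 mulr0 addr0.
Qed.

Definition lyapunov {R : realType} {N : nat} (g : nat -> R) (c : 'I_N -> R)
    (x : N.-tuple nat) : R :=
  \sum_(i < N) c i * cumul g (tnth x i).

(** [cumul_step] is weighted by [c], summed over the queues and integrated given [X k = x];
    independence of arrivals and services gives the product probabilities. As all other terms are
    real, the identity also shows that the mean of [lyapunov g c] after one step is finite. *)
Lemma kernel_drift (d : measure_display) (T : measurableType d)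
    (R : realType) (P : probability T R) (N : nat)
    (alpha : probability (N.-tuple nat) R)
    (sigma : N.-tuple nat -> probability (N.-tuple bool) R)
    (X xi : nat -> {RV P >-> N.-tuple nat})
    (eta : nat -> {RV P >-> N.-tuple bool})
    (S : set (N.-tuple nat)) (p : N.-tuple nat -> N.-tuple nat -> R)
    (lambda : 'rV[R]_N) (g : nat -> R) (c : 'I_N -> R) (x : N.-tuple nat) :
  queueing_network alpha sigma X xi eta ->
  markov_chain S p X -> irreducible S p ->
  (forall i,
     ('E_alpha[fun a : N.-tuple nat => (tnth a i)%:R] = (lambda ord0 i)%:E)%E) ->
  (forall i, bernoulli_variable alpha (fun a : N.-tuple nat => tnth a i)) ->
  (forall n, 0 <= g n) -> (forall i, 0 <= c i) -> S x ->
  (\esum_(y in S) ((lyapunov g c y)%:E * (p x y)%:E) +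
   (\sum_(i < N) c i * g (tnth x i) *
      (service_rate sigma x ord0 i * (1 - lambda ord0 i)))%:E =
   (lyapunov g c x + \sum_(i < N) c i * g (tnth x i).+1 *
      ((1 - service_rate sigma x ord0 i) * lambda ord0 i))%:E)%E.
Proof.
move=> net chain irr mean bern g0 c0 Sx.
have [k [mu [mux muL muF]]] := conditional_law net chain irr Sx.
pose psi := service_rate sigma x ord0.
pose l := lambda ord0.
have cumul0 n : 0 <= cumul g n by exact: sumr_ge0.
have V0 y : 0 <= lyapunov g c y by apply: sumr_ge0 => i _; rewrite mulr_ge0.
have mX j y : measurable [set w | X j w = y] by exact: measurable_tuple_nat_fiber.
have mxi (D : set (N.-tuple nat)) : measurable (xi k @^-1` D).
  by apply: measurable_discrete => a; exact: measurable_tuple_nat_fiber.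
have meta (B : set (N.-tuple bool)) : measurable (eta k @^-1` B).
  by apply: measurable_discrete => b; exact: measurable_tuple_bool_fiber.
have muT : mu setT = 1%E.
  have := muL setT setT.
  by rewrite !preimage_setT setTI !probability_setT mule1.
have muxi D : mu (xi k @^-1` D) = alpha D.
  by have := muL setT D; rewrite preimage_setT setTI probability_setT mul1e.
(* With at most one arrival, queue [i] decreases exactly on [dn i] and increases exactly on
   [up i]. *)
pose dn i := eta k @^-1` [set b : N.-tuple bool | tnth b i] `&`
             xi k @^-1` [set a | tnth a i = 0%N].
pose up i := eta k @^-1` [set b : N.-tuple bool | ~~ tnth b i] `&`
             xi k @^-1` [set a | tnth a i = 1%N].
have mdn i : measurable (dn i) by exact: measurableI.
have mup i : measurable (up i) by exact: measurableI.
have law i := bernoulli_variable_law (bern i) (mean i).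
have mudn i : mu (dn i) = (psi i * (1 - l i))%:E.
  rewrite muL service_rateE; have [-> _ _ _] := law i.
  by rewrite EFinM.
have muup i : mu (up i) = ((1 - psi i) * l i)%:E.
  rewrite muL; have [_ -> _ _] := law i.
  rewrite [X in sigma x X](_ : _ = ~` [set b : N.-tuple bool | tnth b i]).
    rewrite probability_setC ?service_rateE ?EFinM ?EFinB//.
    exact: measurable_tuple_bool.
  by apply/seteqP; split=> b /= /negP.
have mterm (a : R) (E : set T) : measurable E ->
    measurable_fun setT (fun w => (a%:E * (\1_E w)%:E)%E : \bar R).
  by move=> mE; apply: measurable_funeM; exact/measurable_EFinP/measurable_indic.
have intE (a : 'I_N -> R) (E : 'I_N -> set T) (e : 'I_N -> R) :
    (forall i, 0 <= a i) -> (forall i, measurable (E i)) ->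
    (forall i, mu (E i) = (e i)%:E) ->
    [/\ forall w, (0 <= \sum_(i < N) (a i)%:E * (\1_(E i) w)%:E)%E,
        measurable_fun setT
          (fun w => (\sum_(i < N) (a i)%:E * (\1_(E i) w)%:E)%E : \bar R)
      & (\int[mu]_w (\sum_(i < N) (a i)%:E * (\1_(E i) w)%:E) =
        (\sum_(i < N) a i * e i)%:E)%E].
  move=> a0 mE eE; split.
  - by move=> w; apply: sume_ge0 => i _; rewrite mule_ge0 ?lee_fin.
  - by apply: emeasurable_sum => i; exact: mterm.
  rewrite ge0_integral_sum//.
  - rewrite -sumEFin; apply: eq_bigr => i _.
    rewrite ge0_integralZl_EFin//; last exact/measurable_EFinP/measurable_indic.
    rewrite EFinM -eE; congr (_ * _)%E.
    by have := integral_indic mu measurableT (mE i); rewrite setIT.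
  - by move=> i; exact: mterm.
  - by move=> i w _; rewrite mule_ge0 ?lee_fin.
have cg0 n i : 0 <= c i * g n by rewrite mulr_ge0.
have [dn0 mDn intDn] := intE _ _ _ (fun i => cg0 (tnth x i) i) mdn mudn.
have [up0 mUp intUp] := intE _ _ _ (fun i => cg0 (tnth x i).+1 i) mup muup.
have mV : measurable_fun setT (fun w => (lyapunov g c (X k.+1 w))%:E).
  exact: (measurable_fun_discrete (mX k.+1) (fun y => (lyapunov g c y)%:E)).
rewrite -(muF (fun y => (lyapunov g c y)%:E)); last by move=> y; rewrite lee_fin.
rewrite -intDn EFinD -intUp -ge0_integralD//; last by move=> w _; rewrite lee_fin.
have <- : (\int[mu]_w (lyapunov g c x)%:E = (lyapunov g c x)%:E)%E.
  by rewrite integral_cst// muT mule1.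
rewrite -ge0_integralD//; last by move=> w _; rewrite lee_fin.
apply: ge0_ae_eq_integral => //.
- exact: emeasurable_funD.
- exact: emeasurable_funD.
- by move=> w _; rewrite adde_ge0 ?lee_fin.
- by move=> w _; rewrite adde_ge0 ?lee_fin.
(* The integrands agree outside a null set: the union of these events and of the event that [X k]
   differs from [x]. *)
pose bad i := xi k @^-1` [set a | ~ (tnth a i = 0%N \/ tnth a i = 1%N)].
have [mbad bad0] : measurable (\big[setU/set0]_(i < N) bad i) /\
    mu (\big[setU/set0]_(i < N) bad i) = 0%E.
  apply: (big_ind (fun B => measurable B /\ mu B = 0%E)).
  - by split.
  - move=> A B [mA A0] [mB B0]; split; first exact: measurableU.
    exact: null_set_setU.
  - by move=> i _; split; [exact: mxi|rewrite muxi]; have [] := law i.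
exists ([set w | X k w <> x] `|` \big[setU/set0]_(i < N) bad i); split.
- by apply: measurableU => //; apply: measurableC; exact: mX.
- by apply: null_set_setU => //; apply: measurableC; exact: mX.
move=> w /=; apply: contra_notP => /not_orP[/contrapT Xw good] _.
have {}good i : tnth (xi k w) i = 0%N \/ tnth (xi k w) i = 1%N.
  apply: contrapT => bad_i; apply: good; rewrite -bigcup_seq.
  by exists i => //=; rewrite mem_index_enum.
under eq_bigr do rewrite -EFinM.
under [in RHS]eq_bigr do rewrite -EFinM.
rewrite !sumEFin -!EFinD; congr (_%:E); rewrite /lyapunov -!big_split/=.
apply: eq_bigr => i _; rewrite -!mulrA -!mulrDr; congr (_ * _).
have dnE : \1_(dn i) w = (tnth (eta k w) i && (tnth (xi k w) i == 0%N))%:R :> R.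
  rewrite indicE; congr (_%:R); congr nat_of_bool.
  by apply/idP/andP => [/set_mem[/= -> ->]//|[etai /eqP xii]]; apply/mem_set.
have upE : \1_(up i) w =
    (~~ tnth (eta k w) i && (tnth (xi k w) i == 1%N))%:R :> R.
  rewrite indicE; congr (_%:R); congr nat_of_bool.
  by apply/idP/andP => [/set_mem[/= -> ->]//|[etai /eqP xii]]; apply/mem_set.
by rewrite dnE upE -Xw; exact: cumul_step (dynamics net k i w) (good i).
Qed.

(** * Concavity of the utility and optimality of the service rates *)

Lemma utility_real (R : realType) (h : R -> \bar R) (y : R) :
  utility_condition h -> 0 <= y -> h y = -oo%E \/ h y = (fine (h y))%:E.
Proof.
move=> hh y0; have := h_increasing hh y0 (ltr_pwDr ltr01 (lexx y)).
have : h (y + 1) \is a fin_num by apply: h_finite => //; rewrite ltr_wpDl.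
by case: (h y) => [r _ _| |_ _]; [right| case: (h _)|left].
Qed.

(** Concavity on the segment from [x] to [y] bounds the difference quotient in the direction [y - x]
    below by [h y - h x]; its limit at [0] is the derivative times [y - x]. If [h y] is [-oo] the
    bound is trivial. *)
Lemma utility_tangent (R : realType) (h : R -> \bar R) (x y : R) :
  utility_condition h -> 0 < x -> 0 <= y ->
  (h y <= (fine (h x) + derive1 (fine \o h) x * (y - x))%:E)%E.
Proof.
move=> hh x0 y0.
have [->|hy] := utility_real hh y0; first by rewrite leNye.
have hx : h x = (fine (h x))%:E by rewrite fineK// (h_finite hh).
rewrite hy lee_fin -lerBlDl.
set f := fine \o h.
have df : differentiable f x.
  by apply/derivable1_diffP; exact: h_differentiable.
have -> : f^`()%classic x * (y - x) = 'D_(y - x) f x.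
  rewrite derive1E !deriveE// -[y - x in RHS]mulr1 -[_ * 1 in RHS]/(_ *: (1 : R)).
  by rewrite linearZ/= mulrC.
have /cvg_ex[l /= fl] := @diff_derivable _ _ _ f x (y - x) df.
have -> : 'D_(y - x) f x = l by apply: cvg_lim.
(* Concavity applies to [t] between 0 and 1 only, so the two-sided limit is read as a limit from the
   right. *)
have fl0 := cvg_dnbhs_at_right fl.
rewrite -(cvg_lim _ fl0)//; apply: limr_ge; first by apply/cvg_ex; exists l.
near=> t.
have t0 : 0 < t by near: t; exact: nbhs_right_gt.
have t1 : t < 1 by near: t; exact: nbhs_right_lt.
have xt0 : 0 < t * y + (1 - t) * x.
  by rewrite ltr_wpDl ?mulr_ge0 ?mulr_gt0 ?subr_gt0// ltW.
have t01 : 0 <= t <= 1 by rewrite !ltW.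
have := h_concave hh t01 y0 (ltW x0).
rewrite hy hx -(fineK (h_finite hh xt0)) -!EFinM -EFinD lee_fin => le.
rewrite /= [X in f X](_ : _ = t * y + (1 - t) * x); last first.
  by rewrite /GRing.scale/=; ring.
rewrite [_ *: _]mulrC ler_pdivlMr//.
rewrite /f /=; lra.
Unshelve. all: by end_near.
Qed.

(** The tangent at [x], evaluated at [x + x], lies above [h (x + x)], which exceeds [h x]; hence the
    slope times [x] is positive. *)
Lemma utility_derive_ge0 (R : realType) (h : R -> \bar R) (x : R) :
  utility_condition h -> 0 < x -> 0 <= derive1 (fine \o h) x.
Proof.
move=> hh x0; have x20 : 0 < x + x by rewrite addr_gt0.
have := utility_tangent hh x0 (ltW x20).
rewrite -(fineK (h_finite hh x20)) lee_fin addrK => tangent.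
have : fine (h x) < fine (h (x + x)).
  rewrite -lte_fin !fineK ?(h_finite hh)//.
  by apply: (h_increasing hh) (ltW x0) _; rewrite ltrDl.
move=> /lt_le_trans/(_ tangent); rewrite ltrDl => /ltW.
by rewrite pmulr_lge0.
Qed.

(** The total utility of [nu] is at most that of [mu], which the tangents at the [nu i] bound by
    real numbers; the utility of [nu] then cancels. *)
Lemma argmax_tangent (R : realType) (N : nat) (C : set 'rV[R]_N)
    (g : nat -> R) (h : R -> \bar R) (x : N.-tuple nat) (mu nu : 'rV[R]_N) :
  utility_condition h -> (forall n, 0 <= g n) ->
  (forall mu, C mu -> forall i, 0 <= mu ord0 i) ->
  is_argmax C (total_utility g h x) mu -> C nu -> (forall i, 0 < nu ord0 i) ->
  \sum_(i < N) derive1 (fine \o h) (nu ord0 i) * g (tnth x i) *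
    (nu ord0 i - mu ord0 i) <= 0.
Proof.
move=> hh g0 C0 [Cmu max_mu] Cnu nu0.
have : (total_utility g h x nu <= (\sum_(i < N) g (tnth x i) *
    (fine (h (nu ord0 i)) +
     derive1 (fine \o h) (nu ord0 i) * (mu ord0 i - nu ord0 i)))%:E)%E.
  apply: (le_trans (max_mu _ Cnu)); rewrite /total_utility -sumEFin.
  apply: lee_sum => i _; rewrite EFinM lee_wpmul2l ?lee_fin//.
  by apply: utility_tangent => //; exact: C0.
rewrite /total_utility; under eq_bigr.
  move=> i _; rewrite -(fineK (h_finite hh (nu0 i))) -EFinM; over.
rewrite sumEFin lee_fin -subr_ge0 -sumrB => le.
rewrite -oppr_ge0 -sumrN; apply: le_trans le _.
by rewrite le_eqVlt; apply/orP; left; apply/eqP/eq_bigr => i _; ring.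
Qed.

(** * Sums against a stationary distribution *)

(** One inequality holds for finite partial sums with any nonnegative factor; for positive [r] the
    other is the same inequality with factor [r^-1]. *)
Lemma esumZl (R : realType) (I : choiceType) (S : set I) (r : R)
    (a : I -> \bar R) :
  0 <= r -> (forall i, S i -> 0 <= a i)%E ->
  (\esum_(i in S) (r%:E * a i) = r%:E * \esum_(i in S) a i)%E.
Proof.
have leZ (q : R) (b : I -> \bar R) : 0 <= q -> (forall i, S i -> 0 <= b i)%E ->
    (\esum_(i in S) (q%:E * b i) <= q%:E * \esum_(i in S) b i)%E.
  move=> q0 b0; apply: ge_ereal_sup => _ [X [finX XS] <-].
  apply: (@le_trans _ _ (q%:E * \sum_(i \in X) b i)%E).
    rewrite !fsbig_finite// big_seq [in leRHS]big_seq ge0_sume_distrr// => i.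
    by rewrite in_fset_set// inE => /XS/b0.
  by rewrite lee_wpmul2l ?lee_fin//; apply: esum_ge; exists X.
move=> r0 a0; apply/le_anti; rewrite leZ//=.
have [->|rn0] := eqVneq r 0.
  by rewrite mul0e esum_ge0// => i _; rewrite mul0e.
have rp : 0 < r by rewrite lt_def rn0.
have rV0 : 0 <= r^-1 by rewrite invr_ge0.
have ra0 i : S i -> (0 <= r%:E * a i)%E by move=> Si; rewrite mule_ge0 ?lee_fin ?a0.
have := leZ _ _ rV0 ra0.
under eq_esum do rewrite muleA -EFinM mulVf// mul1e.
by rewrite lee_pdivlMl.
Qed.

Lemma exchange_esum (R : realType) (I J : choiceType) (A : set I) (B : set J)
    (a : I -> J -> \bar R) :
  (forall i j, A i -> B j -> 0 <= a i j)%E ->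
  (\esum_(i in A) \esum_(j in B) a i j = \esum_(j in B) \esum_(i in A) a i j)%E.
Proof.
move=> a0; rewrite !esum_esum//; last by move=> j i Bj Ai; exact: a0.
rewrite (reindex_esum (A `*`` (fun=> B)) _ (fun k => (k.2, k.1)))//.
split=> [[i j] []//|[i j] [i' j'] _ _ [-> ->]//|[j i] [Bj Ai]].
by exists (i, j).
Qed.

(* Truncating [V] at [M] makes its stationary mean finite, so that it can be
   subtracted; the drift inequality survives on the set where [V <= M]. *)
Lemma stationary_comparison (R : realType) (N : nat) (S : set (N.-tuple nat))
    (p : N.-tuple nat -> N.-tuple nat -> R) (m : N.-tuple nat -> \bar R)
    (V f s : N.-tuple nat -> R) :
  stochastic_matrix S p -> (forall x, 0 <= m x)%E ->
  \esum_(x in S) m x = 1%E ->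
  (forall y, S y -> m y = \esum_(x in S) (m x * (p x y)%:E))%E ->
  (forall x, 0 <= V x) -> (forall x, 0 <= f x) -> (forall x, 0 <= s x) ->
  (forall x, S x ->
    \esum_(y in S) ((V y)%:E * (p x y)%:E) + (f x)%:E <= (V x + s x)%:E)%E ->
  (\esum_(x in S) ((f x)%:E * m x) <= \esum_(x in S) ((s x)%:E * m x))%E.
Proof.
move=> [p0 p1] m0 m1 stat V0 f0 s0 drift.
apply: ge_ereal_sup => _ [F [finF FS] <-].
(* It suffices to bound the sum over each finite [F]. This [M] dominates [V] on [F], so that [f']
   below agrees with [f] there. *)
pose M := \sum_(x <- finmap.enum_fset (fset_set F)) V x.
have M0 : 0 <= M by exact: sumr_ge0.
have VM x : F x -> V x <= M.
  move=> Fx; rewrite /M (big_rem x)/=; first by rewrite lerDl sumr_ge0.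
  by rewrite in_fset_set// inE.
pose W x := Num.min (V x) M.
have W0 x : 0 <= W x by rewrite le_min V0 M0.
pose PW x := (\esum_(y in S) ((W y)%:E * (p x y)%:E))%E.
have PW0 x : S x -> (0 <= PW x)%E.
  by move=> Sx; apply: esum_ge0 => y Sy; rewrite mule_ge0 ?lee_fin ?p0.
pose f' x := if V x <= M then f x else 0.
have f'0 x : 0 <= f' x by rewrite /f'; case: ifP.
(* Where [V x <= M], the drift of [V] applies since [W <= V]. Elsewhere [f' x] is 0 and [W x] is
   [M], which bounds the mean [PW x]. *)
have driftW x : S x -> (PW x + (f' x)%:E <= (W x)%:E + (s x)%:E)%E.
  move=> Sx; rewrite /f' /W minEle; case: ifPn => _.
    apply: le_trans (drift _ Sx); rewrite leeD2r//.
    apply: le_esum => y Sy; rewrite lee_wpmul2r ?lee_fin ?p0//.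
    by rewrite ge_min lexx.
  rewrite adde0 -[leLHS]adde0 leeD ?lee_fin//.
  have <- : (\esum_(y in S) (M%:E * (p x y)%:E) = M%:E)%E.
    by rewrite esumZl// ?p1 ?mule1// => y Sy; rewrite lee_fin p0.
  apply: le_esum => y Sy; rewrite lee_wpmul2r ?lee_fin ?p0//.
  by rewrite ge_min lexx orbT.
have EW : (\esum_(x in S) (m x * PW x) = \esum_(x in S) ((W x)%:E * m x))%E.
  transitivity (\esum_(x in S) \esum_(y in S) ((W y)%:E * (m x * (p x y)%:E)))%E.
    apply: eq_esum => x Sx; rewrite /PW.
    have mxfin : m x \is a fin_num.
      rewrite ge0_fin_numE//; apply: le_lt_trans (ltry 1); rewrite -m1.
      apply: esum_ge; exists [set x]; last by rewrite fsbig_set1.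
      by split=> [|_ ->//]; exact: finite_set1.
    rewrite -(fineK mxfin) -esumZl ?fine_ge0//; last first.
      by move=> y Sy; rewrite mule_ge0 ?lee_fin ?p0.
    by apply: eq_esum => y Sy; rewrite muleCA.
  rewrite exchange_esum; last first.
    by move=> x y Sx Sy; rewrite !mule_ge0 ?lee_fin ?p0.
  apply: eq_esum => y Sy; rewrite esumZl// ?stat// => x Sx.
  by rewrite mule_ge0 ?lee_fin ?p0.
have Wfin : (\esum_(x in S) ((W x)%:E * m x))%E \is a fin_num.
  rewrite ge0_fin_numE; last by apply: esum_ge0 => x Sx; rewrite mule_ge0 ?lee_fin.
  apply: le_lt_trans (ltry M); rewrite -[leRHS]mule1 -m1 -esumZl//.
  by apply: le_esum => x Sx; rewrite lee_wpmul2r// lee_fin ge_min lexx orbT.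
apply: (@le_trans _ _ (\esum_(x in S) ((f' x)%:E * m x))%E).
  apply: esum_ge; exists F => //; rewrite le_eqVlt; apply/orP; left; apply/eqP.
  by apply: eq_fsbigr => x /set_mem Fx; rewrite /f' VM.
(* The finite mean of [W] is added to both sides and rewritten on the left as the mean of [PW], by
   stationarity; [driftW] then compares the terms. *)
rewrite -(leeD2lE _ _ Wfin) -{1}EW -!esumD;
  do ?by move=> x Sx; rewrite mule_ge0 ?lee_fin ?PW0.
apply: le_esum => x Sx; rewrite -ge0_muleDl ?lee_fin//.
rewrite [(_ * m x)%E in leLHS]muleC -ge0_muleDr ?PW0 ?lee_fin//.
by rewrite [leRHS]muleC lee_wpmul2l// driftW.
Qed.

(** Each expectation is a series over the law of [Y], which has no mass outside [S]; finite and
    countable sums of nonnegative terms commute. *)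
Lemma sum_expectation (d : measure_display) (T : measurableType d)
    (R : realType) (Q : probability T R) (N : nat)
    (Y : {RV Q >-> N.-tuple nat}) (S : set (N.-tuple nat)) (c : 'I_N -> R)
    (phi : nat -> R) :
  distribution Q Y S = 1%E -> (forall i, 0 <= c i) -> (forall n, 0 <= phi n) ->
  (\sum_(i < N) (c i)%:E * 'E_Q[fun w => phi (tnth (Y w) i)] =
   \esum_(x in S) ((\sum_(i < N) c i * phi (tnth x i))%:E *
                   distribution Q Y [set x]))%E.
Proof.
move=> QS c0 phi0.
have mY x : measurable [set w | Y w = x] by exact: measurable_tuple_nat_fiber.
have offS x : ~ S x -> distribution Q Y [set x] = 0%E.
  move=> nSx; apply/le_anti; rewrite measure_ge0 andbT.
  have <- : distribution Q Y (~` S) = 0%E.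
    rewrite probability_setC; last exact: measurable_tuple_nat.
    by rewrite [X in (1 - X)%E]QS subee.
  apply: le_measure; rewrite ?inE; last by move=> _ ->.
  - exact: measurable_tuple_nat.
  - exact: measurable_tuple_nat.
have EE i : ('E_Q[fun w => phi (tnth (Y w) i)] =
    \esum_(x in S) ((phi (tnth x i))%:E * distribution Q Y [set x]))%E.
  rewrite unlock (integral_discrete Q mY (S := setT)
    (phi := fun x => (phi (tnth x i))%:E))//; last by move=> x; rewrite lee_fin.
  rewrite [RHS]esum_mkcond; apply: eq_esum => x _.
  have -> : [set: T] `&` [set w | Y w = x] = Y @^-1` [set x] by rewrite setTI.
  case: ifPn => // /negP nSx; rewrite -[RHS](mule0 (phi (tnth x i))%:E).
  by congr (_ * _)%E; apply: offS => /mem_set.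
transitivity (\sum_(i < N) \esum_(x in S)
    ((c i * phi (tnth x i))%:E * distribution Q Y [set x]))%E.
  apply: eq_bigr => i _; rewrite EE -esumZl//.
    by apply: eq_esum => x _; rewrite EFinM muleA.
  by move=> x _; rewrite mule_ge0 ?lee_fin.
rewrite -esum_sum; last first.
  by move=> x i _ _; rewrite mule_ge0 ?lee_fin// mulr_ge0.
apply: eq_esum => x _; rewrite -sumEFin ge0_sume_distrl// => i _.
by rewrite lee_fin mulr_ge0.
Qed.

(** * Drift, tangent inequality and stationarity combined *)

Theorem theorem2 (R : realType) (N : nat)
  (* the network and its Markov chain *)
  (d : measure_display) (T : measurableType d) (P : probability T R)
  (alpha : probability (N.-tuple nat) R)
  (sigma : N.-tuple nat -> probability (N.-tuple bool) R)
  (X xi : nat -> {RV P >-> N.-tuple nat})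
  (eta : nat -> {RV P >-> N.-tuple bool})
  (hnet : queueing_network alpha sigma X xi eta)
  (S : set (N.-tuple nat)) (p : N.-tuple nat -> N.-tuple nat -> R)
  (hchain : markov_chain S p X) (hirr : irreducible S p)
  (* utility-maximising service *)
  (g : nat -> R) (hg : weight_condition g)
  (h : R -> \bar R) (hh : utility_condition h)
  (C : set 'rV[R]_N) (hCcompact : compact C)
  (hCnonneg : forall mu, C mu -> forall i, 0 <= mu ord0 i)
  (hCconvex : coordinate_convex C)
  (hempty : forall x i, S x -> tnth x i = 0%N ->
     service_rate sigma x ord0 i = 0)
  (hargmax : forall x, S x ->
     is_argmax C (total_utility g h x) (service_rate sigma x))
  (* arrivals *)
  (lambda : 'rV[R]_N)
  (hmean : forall i,
     ('E_alpha[fun a : N.-tuple nat => (tnth a i)%:R] = (lambda ord0 i)%:E)%E)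
  (hbern : forall i,
     bernoulli_variable alpha (fun a : N.-tuple nat => tnth a i))
  (nu : 'rV[R]_N) (hnu : C nu) (eps : R) (heps : 0 < eps)
  (hlambda : forall i, lambda ord0 i < nu ord0 i - eps)
  (* a random vector with the stationary distribution *)
  (d' : measure_display) (T' : measurableType d') (Q : probability T' R)
  (Y : {RV Q >-> N.-tuple nat})
  (hY : stationary_distribution S p (distribution Q Y)) :
  (\sum_(i < N) (derive1 (fine \o h) (nu ord0 i))%:E *
      'E_Q[fun w => g (tnth (Y w) i)]
   <= (eps^-1)%:E *
      \sum_(i < N) (derive1 (fine \o h) (nu ord0 i))%:E *
        'E_Q[fun w => increment g (tnth (Y w) i)])%E.
Proof.
have g0 := g_nonneg hg.
have dg0 n : 0 <= increment g n.
  by rewrite subr_ge0 ltW// (g_increasing hg).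
have l01 i : 0 <= lambda ord0 i <= 1.
  by have [] := bernoulli_variable_law (hbern i) (hmean i).
(* Positivity of [nu i], from [nu i > lambda i + eps], places it where [h] is finite and
   differentiable. *)
have nu0 i : 0 < nu ord0 i by move: (hlambda i) (l01 i) heps; lra.
pose c i := derive1 (fine \o h) (nu ord0 i).
have c0 i : 0 <= c i by exact: utility_derive_ge0.
have [QS stat] := hY.
rewrite (sum_expectation QS c0 g0) (sum_expectation QS c0 dg0).
set F := fun x : N.-tuple nat => \sum_(i < N) c i * g (tnth x i).
set D := fun x : N.-tuple nat => \sum_(i < N) c i * increment g (tnth x i).
have F0 x : 0 <= F x by apply: sumr_ge0 => i _; rewrite mulr_ge0.
have D0 x : 0 <= D x by apply: sumr_ge0 => i _; rewrite mulr_ge0.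
rewrite lee_pdivlMl// -(esumZl (ltW heps)); last first.
  by move=> x _; apply: mule_ge0 => //; rewrite lee_fin; exact: F0.
under eq_esum do rewrite muleA -EFinM.
have [stoch XS _] := hchain.
apply: (stationary_comparison
  (m := fun x => distribution Q Y [set x]) (V := lyapunov g c)
  (f := fun x => eps * F x) (s := D) stoch) => //.
- apply: (etrans _ QS); apply/esym.
  apply: etrans (measure_discrete (distribution Q Y) (f := id) (S := S)
    (fun x => measurable_tuple_nat _) (measurable_tuple_nat S) _) _ => //.
  apply: eq_esum => x Sx; congr (distribution Q Y _).
  by apply/seteqP; split=> [y []//|_ ->].
- by move=> x; apply: sumr_ge0 => i _; rewrite mulr_ge0 ?sumr_ge0.
- by move=> x; rewrite mulr_ge0// ltW.
move=> x Sx.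
have := kernel_drift hnet hchain hirr hmean hbern g0 c0 Sx.
set PV := (\esum_(y in S) _)%E.
have psi01 i : 0 <= service_rate sigma x ord0 i <= 1.
  rewrite -!lee_fin -service_rateE measure_ge0/=; apply: probability_le1.
  exact: measurable_tuple_bool.
have := argmax_tangent hh g0 hCnonneg (hargmax x Sx) hnu nu0.
set psi := service_rate sigma x in psi01 *.
(* The drift identity has a real right-hand side, so [PV] is finite. *)
case: PV => [r| |]//; rewrite -EFinD => tangent [drift].
rewrite -EFinD lee_fin.
set E1 := \sum_(i < N) _ in drift.
set E2 := \sum_(i < N) _ in drift.
suff : E2 + eps * F x <= E1 + D x by move: drift; lra.
(* The added sum is nonpositive by [tangent]. It replaces the service rates by [nu], after which the
   inequality holds queue by queue: the [g] coefficient is [nu i - eps - lambda i], and that of the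
   increment is one minus the probability of an upward step. *)
apply: (@le_trans _ _ (E1 + D x +
    \sum_(i < N) c i * g (tnth x i) * (nu ord0 i - psi ord0 i))); last first.
  by move: tangent; rewrite -/c; lra.
rewrite /E1 /E2 /F /D mulr_sumr -!big_split/=; apply: ler_sum => i _.
rewrite -subr_ge0 [leRHS](_ : _ = c i *
  (g (tnth x i) * (nu ord0 i - eps - lambda ord0 i) +
   increment g (tnth x i) * (1 - (1 - psi ord0 i) * lambda ord0 i)));
  last by rewrite /increment; ring.
have /andP[l0 l1] := l01 i; have /andP[psi0 psi1] := psi01 i.
rewrite mulr_ge0// addr_ge0// mulr_ge0//; first by rewrite subr_ge0 ltW.
by rewrite subr_ge0 mulr_ile1// ?subr_ge0// gerBl.
Qed.
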